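(* Let $\mathcal H$ be a finite-dimensional real Hilbert space, $\mathcal A:\mathcal H\to 2^{\mathcal H}$ a maximally monotone operator that is $\mu$-strongly monotone with $\mu>0$, and $\mathcal Q:\mathcal H\to\mathcal H$ a positive definite (not necessarily symmetric) linear operator. Let $\mathcal T:=(\mathcal A+\mathcal Q)^{-1}\mathcal Q$ and $\mathcal R:=\mathcal I-\mathcal T$. Then the following hold. (i) $\mathcal T$ is $\mathcal Q$-based $\big(1+\frac{\mu}{\|\mathcal Q\|}\big)$-cocoercive, and $\mathcal R$ is $\mathcal Q^\top$-based $1$-cocoercive. (ii) If $\mathcal Q$ is symmetric positive semi-definite, then $\mathcal T\in\mathcal F^{\mathcal Q}_{\frac{\|\mathcal Q\|}{2\mu+\|\mathcal Q\|},\ \frac{2\mu+\|\mathcal Q\|}{2\mu+2\|\mathcal Q\|}}$ and $\mathcal R\in\mathcal F^{\mathcal Q}_{1,\ \frac{\|\mathcal Q\|}{2(\|\mathcal Q\|+\mu)}}$. (iii) If $\mathcal Q$ is symmetric positive semi-definite, then both $\mathcal T$ and $\mathcal R$ are $\mathcal Q$-firmly nonexpansive. (iv) If $\mathcal Q$ is symmetric positive definite, then for all $b_1,b_2\in\mathcal H$, $$\langle b_1-b_2\,|\,\mathcal Rb_1-\mathcal Rb_2\rangle_{\mathcal Q}\ \ge\ \frac{\|\mathcal Q\|+\mu}{\|\mathcal Q\|+2\mu}\,\|\mathcal Rb_1-\mathcal Rb_2\|_{\mathcal Q}^2+\frac{\mu}{\|\mathcal Q\|+2\mu}\,\|b_1-b_2\|_{\mathcal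 Q}^2 .$$
   Context: The hypothesis that $\mathcal Q$ is positive definite ($\langle\mathcal Qx|x\rangle>0$ for $x\ne0$) is in force in all four parts. $\|\mathcal Q\|$ is the operator norm and $\mathcal Q^\top$ the adjoint. For a linear operator $\mathcal P$ on $\mathcal H$: $\langle a|b\rangle_{\mathcal P}:=\langle \mathcal Pa|b\rangle$ and $\|a\|_{\mathcal P}^2:=\langle\mathcal Pa|a\rangle$. $\mathcal A$ is $\mu$-strongly monotone if $\langle u_1-u_2|b_1-b_2\rangle\ge\mu\|b_1-b_2\|^2$ whenever $u_i\in\mathcal Ab_i$. $\mathcal T=(\mathcal A+\mathcal Q)^{-1}\mathcal Q$ means: $a=\mathcal Tb$ iff $\mathcal Qb\in\mathcal Aa+\mathcal Qa$ (under these hypotheses it is single-valued with full domain). An operator $\mathcal S:\mathcal H\to\mathcal H$ is $\mathcal P$-based $\beta$-cocoercive if $\langle b_1-b_2|\mathcal Sb_1-\mathcal Sb_2\rangle_{\mathcal P}\ge\beta\|\mathcal Sb_1-\mathcal Sb_2\|_{\mathcal P}^2$ for all $b_1,b_2$. It is $\mathcal Q$-based $\xi$-Lipschitz continuous if $\|\mathcal Sb_1-\mathcal Sb_2\|_{\mathcal Q}^2\le\xi^2\|b_1-b_2\|_{\mathcal Q}^2$ for all $b_1,b_2$. For $\xi\in\,]0,+\infty[$, $\alpha\in\,]0,1[$, $\mathcal S\in\mathcal F^{\mathcal Q}_{\xi,\alpha}$ means $\mathcal S=(1-\alpha)\mathcal I+\alpha\mathcal K$ for some $\mathcal Q$-based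 $\xi$-Lipschitz continuous $\mathcal K:\mathcal H\to\mathcal H$. $\mathcal S$ is $\mathcal Q$-firmly nonexpansive if $\mathcal S\in\mathcal F^{\mathcal Q}_{1,\frac12}$. *)

(* Defs.v *)
From HB Require Import structures.
From mathcomp Require Import all_boot all_order all_algebra.
From mathcomp Require Import boolp classical_sets reals.

Set Implicit Arguments.
Unset Strict Implicit.
Unset Printing Implicit Defensive.

Import Order.TTheory GRing.Theory Num.Theory.

Local Open Scope classical_set_scope.
Local Open Scope ring_scope.

(* A finite-dimensional real Hilbert space is a vectType H over a realType R
   with a positive definite symmetric bilinear form ip : {dot H for idfun};
   completeness is automatic in finite dimension. *)

Section Hilbert.
Variables (R : realType) (H : vectType R) (ip : {dot H for idfun}).

Definition hnorm (x : H) : R := Num.sqrt (ip x x).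

Definition opnorm (Q : 'End(H)) : R :=
  sup [set hnorm (Q x) | x in [set x : H | hnorm x <= 1]].

(* The adjoint exists and is unique in finite dimension, so the default value
   of xget is never used. *)
Definition adjoint (Q : 'End(H)) : 'End(H) :=
  xget 0 [set Qt : 'End(H) | forall x y, ip (Q x) y = ip x (Qt y)].

Definition ip_of (P : 'End(H)) (a b : H) : R := ip (P a) b.

Definition sqnorm_of (P : 'End(H)) (a : H) : R := ip (P a) a.

Definition posdef (Q : 'End(H)) : Prop := forall x, x != 0 -> 0 < ip (Q x) x.

Definition possemidef (Q : 'End(H)) : Prop := forall x, 0 <= ip (Q x) x.

Definition selfadjoint (Q : 'End(H)) : Prop :=
  forall x y, ip (Q x) y = ip x (Q y).

(* Set-valued operators H -> 2^H are functions H -> set H: [A b u] means that u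
   belongs to A b. *)

Definition monotone (A : H -> set H) : Prop :=
  forall b1 b2 u1 u2, A b1 u1 -> A b2 u2 -> 0 <= ip (u1 - u2) (b1 - b2).

Definition maximally_monotone (A : H -> set H) : Prop :=
  monotone A /\
  forall B : H -> set H, monotone B ->
    (forall b, A b `<=` B b) -> forall b, B b `<=` A b.

Definition strongly_monotone (mu : R) (A : H -> set H) : Prop :=
  forall b1 b2 u1 u2, A b1 u1 -> A b2 u2 ->
    mu * hnorm (b1 - b2) ^+ 2 <= ip (u1 - u2) (b1 - b2).

Definition op_add (A : H -> set H) (Q : H -> H) : H -> set H :=
  fun a => [set u + Q a | u in A a].

Definition op_inv (A : H -> set H) : H -> set H := fun u => [set a | A a u].

Definition resolvent_rel (A : H -> set H) (Q : 'End(H)) : H -> set H :=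
  fun b => op_inv (op_add A Q) (Q b).

(* T = (A + Q)^-1 Q as a map: the value at b is the element of the set
   (A + Q)^-1 (Q b), which is a singleton when A is maximally monotone and Q is
   positive definite; 0 is a dummy value for the empty set. *)
Definition resolvent (A : H -> set H) (Q : 'End(H)) (b : H) : H :=
  xget 0 (resolvent_rel A Q b).

Definition cocoercive (P : 'End(H)) (beta : R) (S : H -> H) : Prop :=
  forall b1 b2,
    beta * sqnorm_of P (S b1 - S b2) <= ip_of P (b1 - b2) (S b1 - S b2).

Definition lipschitz (Q : 'End(H)) (xi : R) (K : H -> H) : Prop :=
  forall b1 b2,
    sqnorm_of Q (K b1 - K b2) <= xi ^+ 2 * sqnorm_of Q (b1 - b2).

Definition Fclass (Q : 'End(H)) (xi alpha : R) (S : H -> H) : Prop :=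
  [/\ 0 < xi, 0 < alpha, alpha < 1 &
    exists2 K : H -> H, lipschitz Q xi K &
      forall b, S b = (1 - alpha) *: b + alpha *: K b].

Definition firmly_nonexpansive (Q : 'End(H)) (S : H -> H) : Prop :=
  Fclass Q 1 (2^-1) S.

End Hilbert.

(* Main.v *)
Require Import Defs.
From HB Require Import structures.
From mathcomp Require Import all_boot all_order all_algebra.
From mathcomp Require Import boolp classical_sets reals.
From mathcomp Require Import topology normedtype derive.
From mathcomp Require finmap.
From mathcomp Require Import ring lra.

Import Order.TTheory GRing.Theory Num.Theory.
Import numFieldNormedType.Exports.

Local Open Scope classical_set_scope.
Local Open Scope ring_scope.

(* If [Q b_i - Q a_i] lies in [A a_i], strong monotonicity of [A] gives, for
   [a = a_1 - a_2] and [b = b_1 - b_2], [mu |a|^2 + <Q a | a> <= <Q b | a>].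
   Together with [<Q a | a> <= |Q| |a|^2] this is
   [(|Q| + mu) <Q a | a> <= |Q| <Q b | a>], from which all four parts follow by
   expanding quadratic forms.

   That [T] has full domain is Minty's theorem with [Q] in place of the
   identity: one needs [a] with [g_(y, v) a = <v - w + Q a | y - a> >= 0] for
   all [(y, v)] in the graph of [A]. Each [g_(y, v)] is concave and
   [sum_i l_i g_i >= 0] at the barycentre of the [y_i] with weights [l_i], by
   monotonicity; a penalty minimisation then solves any finite subsystem, and
   compactness solves the full one. Writing [A = (A - mu) + mu] makes the
   solution sets bounded. *)

Lemma subrACA (V : zmodType) (x y z t : V) : x - y - (z - t) = x - z - (y - t).
Proof. by rewrite !opprB addrACA [RHS]addrACA [- y + _]addrC. Qed.

(** * Inner product and Cauchy-Schwarz *)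

Section InnerProduct.
Set Implicit Arguments.
Unset Strict Implicit.
Variables (R : realType) (H : vectType R) (ip : {dot H for idfun}).
Implicit Types x y : H.

Lemma ipC x y : ip x y = ip y x.
Proof. by rewrite hermC expr0 mul1r. Qed.

Lemma ipDl x y z : ip (x + y) z = ip x z + ip y z.
Proof. exact: linearDl. Qed.

Lemma ipDr x y z : ip x (y + z) = ip x y + ip x z.
Proof. exact: linearDr. Qed.

Lemma ipBl x y z : ip (x - y) z = ip x z - ip y z.
Proof. exact: linearBl. Qed.

Lemma ipBr x y z : ip x (y - z) = ip x y - ip x z.
Proof. exact: linearBr. Qed.

Lemma ipNl x y : ip (- x) y = - ip x y.
Proof. exact: linearNl. Qed.

Lemma ipNr x y : ip x (- y) = - ip x y.
Proof. exact: linearNr. Qed.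

Lemma ipZl c x y : ip (c *: x) y = c * ip x y.
Proof. exact: linearZl_LR. Qed.

Lemma ipZr c x y : ip x (c *: y) = c * ip x y.
Proof. by rewrite ipC ipZl ipC. Qed.

Definition ip_linE := (ipDl, ipDr, ipNl, ipNr, ipZl, ipZr).

Lemma ip0l x : ip 0 x = 0.
Proof. exact: linear0l. Qed.

Lemma ip0r x : ip x 0 = 0.
Proof. exact: linear0r. Qed.

Lemma ip_suml (I : Type) (r : seq I) (F : I -> H) y :
  ip (\sum_(i <- r) F i) y = \sum_(i <- r) ip (F i) y.
Proof. exact: linear_sumlz. Qed.

Lemma ip_sumr (I : Type) (r : seq I) (F : I -> H) y :
  ip y (\sum_(i <- r) F i) = \sum_(i <- r) ip y (F i).
Proof. exact: linear_sumr. Qed.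

Lemma ip_gt0 x : x != 0 -> 0 < ip x x.
Proof. exact: neq0_dnorm_gt0. Qed.

Lemma ip_ge0 x : 0 <= ip x x.
Proof. by have [->|/ip_gt0/ltW//] := eqVneq x 0; rewrite ip0l. Qed.

Lemma ip_eq0 x : ip x x <= 0 -> x = 0.
Proof. by have [//|/ip_gt0] := eqVneq x 0; rewrite ltNge => /negbTE->. Qed.

Lemma hnorm_sqr x : hnorm ip x ^+ 2 = ip x x.
Proof. by rewrite sqr_sqrtr // ip_ge0. Qed.

Lemma hnorm_ge0 x : 0 <= hnorm ip x.
Proof. exact: sqrtr_ge0. Qed.

(** Multiplied by [ip y y], the difference of the two sides is the square of
    [ip y y *: x - ip x y *: y]. *)
Lemma ip_sqr_le x y : ip x y ^+ 2 <= ip x x * ip y y.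
Proof.
have [->|y0] := eqVneq y 0; first by rewrite !ip0r expr0n mulr0.
rewrite -subr_ge0 -(pmulr_rge0 _ (ip_gt0 y0)).
have := ip_ge0 (ip y y *: x - ip x y *: y).
rewrite ipBl !ipBr !ipZl !ipZr (ipC y x); congr (0 <= _); ring.
Qed.

Lemma norm_ip_le x y : `|ip x y| <= hnorm ip x * hnorm ip y.
Proof.
rewrite -(@ler_pXn2r _ 2) ?nnegrE ?mulr_ge0 ?hnorm_ge0 //.
by rewrite exprMn !hnorm_sqr real_normK ?num_real // ip_sqr_le.
Qed.

Lemma ip_le x y : ip x y <= hnorm ip x * hnorm ip y.
Proof. exact: le_trans (ler_norm _) (norm_ip_le x y). Qed.

Lemma hnorm_eq0 x : hnorm ip x = 0 -> x = 0.
Proof. by move=> x0; apply: ip_eq0; rewrite -hnorm_sqr x0 expr0n. Qed.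

Lemma hnorm0 : hnorm ip 0 = 0.
Proof. by rewrite /hnorm ip0l sqrtr0. Qed.

Lemma hnormZ c x : hnorm ip (c *: x) = `|c| * hnorm ip x.
Proof.
by rewrite /hnorm ipZl ipZr mulrA -expr2 sqrtrM ?sqr_ge0 // sqrtr_sqr.
Qed.

Lemma hnorm_triangle x y : hnorm ip (x + y) <= hnorm ip x + hnorm ip y.
Proof.
rewrite -(@ler_pXn2r _ 2) ?nnegrE ?addr_ge0 ?hnorm_ge0 //.
rewrite sqrrD !hnorm_sqr ipDl !ipDr (ipC y x).
have := ip_le x y; lra.
Qed.

Lemma hnorm_sum (I : Type) (r : seq I) (F : I -> H) :
  hnorm ip (\sum_(i <- r) F i) <= \sum_(i <- r) hnorm ip (F i).
Proof.
elim: r => [|i r IH]; first by rewrite !big_nil hnorm0.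
by rewrite !big_cons (le_trans (hnorm_triangle _ _)) // lerD2l.
Qed.

(** * Riesz representatives, operator norm and adjoint *)

Let n : nat := \dim {:H}.
Let b := vbasis {:H}.

Lemma vbasis_sum x : x = \sum_(i < n) coord b i x *: b`_i.
Proof. exact/coord_vbasis/memvf. Qed.

(* The Gram matrix of a basis is invertible, which yields the Riesz
   representatives of the coordinate forms. *)
Lemma coord_ip : exists z : 'I_n -> H, forall i x, coord b i x = ip x (z i).
Proof.
pose G := \matrix_(i < n, j < n) ip b`_i b`_j.
have Gu : G \in unitmx.
  (* A row killed by [G] gives a combination [x] orthogonal to every basis vector, hence to
     itself. *)
  rewrite -row_free_unit; apply/inj_row_free => v vG0.
  pose x := \sum_(i < n) v 0 i *: b`_i.
  have xb (j : 'I_n) : ip x b`_j = 0.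
    have := congr1 (fun M : 'rV_n => M 0 j) vG0; rewrite !mxE => <-.
    by rewrite ip_suml; apply: eq_bigr => i _; rewrite ipZl mxE.
  have x0 : x = 0.
    apply: ip_eq0; rewrite {2}/x ip_sumr big1 // => j _.
    by rewrite ipZr xb mulr0.
  apply/rowP => i; rewrite mxE.
  have := coord_sum_free (v 0) i (basis_free (vbasisP {:H})).
  by rewrite -/b -/x x0 linear0 => <-.
exists (fun i => \sum_(k < n) invmx G k i *: b`_k) => i x.
pose c := \row_i coord b i x.
have -> : coord b i x = (c *m G *m invmx G) 0 i.
  by rewrite mulmxK // mxE.
rewrite mxE ip_sumr; apply: eq_bigr => k _; rewrite ipZr mulrC; congr (_ * _).
rewrite mxE [X in ip X _]vbasis_sum ip_suml.
by apply: eq_bigr => j _; rewrite ipZl !mxE.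
Qed.

(** Each coordinate is bounded through its Riesz representative. This makes the supremum in [opnorm]
    one over a bounded set. *)
Lemma linear_bounded (Q : 'End(H)) :
  exists C, forall x, hnorm ip (Q x) <= C * hnorm ip x.
Proof.
have [z zP] := coord_ip.
exists (\sum_(i < n) hnorm ip (z i) * hnorm ip (Q b`_i)) => x.
rewrite {1}(vbasis_sum x) linear_sum (le_trans (hnorm_sum _ _)) // mulr_suml.
apply: ler_sum => i _; rewrite linearZ hnormZ zP mulrAC ler_wpM2r ?hnorm_ge0 //.
by rewrite mulrC norm_ip_le.
Qed.

Lemma le_opnorm (Q : 'End(H)) x :
  hnorm ip x <= 1 -> hnorm ip (Q x) <= opnorm ip Q.
Proof.
move=> x1; have [C CP] := linear_bounded Q.
apply: ub_le_sup; last by exists x.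
exists `|C| => _ [w w1 <-]; apply: le_trans (CP w) _.
apply: le_trans (ler_norm _) _; rewrite normrM.
by rewrite ler_piMr // ger0_norm ?hnorm_ge0.
Qed.

Lemma opnorm_ge0 (Q : 'End(H)) : 0 <= opnorm ip Q.
Proof.
by have := @le_opnorm Q 0; rewrite linear0 hnorm0 => ->.
Qed.

Lemma opnorm_bound (Q : 'End(H)) x : hnorm ip (Q x) <= opnorm ip Q * hnorm ip x.
Proof.
have [->|x0] := eqVneq x 0; first by rewrite linear0 hnorm0 mulr0.
have xgt0 : 0 < hnorm ip x.
  by rewrite lt_def hnorm_ge0 andbT; apply: contra x0 => /eqP/hnorm_eq0->.
have := @le_opnorm Q ((hnorm ip x)^-1 *: x).
rewrite linearZ !hnormZ normfV ger0_norm ?hnorm_ge0 // mulVf ?gt_eqF //.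
by move=> /(_ (lexx _)); rewrite mulrC ler_pdivrMr.
Qed.

Lemma sqnorm_le_opnorm (Q : 'End(H)) x :
  ip (Q x) x <= opnorm ip Q * ip x x.
Proof.
rewrite -hnorm_sqr expr2 mulrA (le_trans (ip_le _ _)) //.
by rewrite ler_wpM2r ?hnorm_ge0 ?opnorm_bound.
Qed.

(** The Riesz vectors give an explicit adjoint [f], so [xget] does not fall back on its default. *)
Lemma adjointP (Q : 'End(H)) x y : ip (Q x) y = ip x (adjoint ip Q y).
Proof.
have [z zP] := coord_ip.
pose f y := \sum_(i < n) ip (Q b`_i) y *: z i.
have fl : linear f.
  move=> c u v; rewrite /f scaler_sumr -big_split; apply: eq_bigr => i _ /=.
  by rewrite ipDr ipZr scalerDl scalerA.
pose fL := GRing.isLinear.Build R H H _ f fl.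
pose F : {linear H -> H} := HB.pack f fL.
have : [set Qt : 'End(H) | forall x y, ip (Q x) y = ip x (Qt y)] (linfun F).
  move=> u v; rewrite (lfunE F v) /= /f ip_sumr {1}(vbasis_sum u) linear_sum.
  rewrite ip_suml; apply: eq_bigr => i _.
  by rewrite linearZ ipZl ipZr zP mulrC.
by move=> FP; rewrite /adjoint; case: xgetP => [Qt _ ->|/(_ (linfun F))].
Qed.

End InnerProduct.

(** * Solvability of monotone inclusions *)

Section Minty.
Set Implicit Arguments.
Unset Strict Implicit.
Variables (R : realType) (H : vectType R) (ip : {dot H for idfun}).

(** At the centroid the contribution of [c] cancels. Multiplying by the total weight turns the rest
    into a double sum [S]; exchanging its indices shows that [S + S] is a weighted sum of
    monotonicity products. *)
Lemma weighted_centroid_ge0 (s : seq (H * H)) (l : H * H -> R) (c m : H) :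
    (forall p p', p \in s -> p' \in s -> 0 <= ip (p.2 - p'.2) (p.1 - p'.1)) ->
    (forall p, p \in s -> 0 <= l p) -> 0 < \sum_(p <- s) l p ->
    (\sum_(p <- s) l p) *: m = \sum_(p <- s) l p *: p.1 ->
  0 <= \sum_(p <- s) l p * ip (p.2 + c) (p.1 - m).
Proof.
move=> smon l_ge0; set L := \sum_(p <- s) l p => L_gt0 Lm.
rewrite -(pmulr_rge0 _ L_gt0).
have shift : \sum_(p <- s) l p * ip c (p.1 - m) = 0.
  transitivity (ip c (\sum_(p <- s) l p *: p.1 - L *: m)); last first.
    by rewrite Lm subrr ip0r.
  rewrite /L scaler_suml -sumrB ip_sumr; apply: eq_bigr => p _.
  by rewrite -scalerBr ipZr.
have -> : \sum_(p <- s) l p * ip (p.2 + c) (p.1 - m) =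
    \sum_(p <- s) l p * ip p.2 (p.1 - m).
  under eq_bigr do rewrite ipDl mulrDr.
  by rewrite big_split /= shift addr0.
pose S := \sum_(p <- s) \sum_(p' <- s) l p * l p' * ip p.2 (p.1 - p'.1).
have -> : L * (\sum_(p <- s) l p * ip p.2 (p.1 - m)) = S.
  rewrite mulr_sumr; apply: eq_bigr => p _.
  rewrite mulrCA -ipZr scalerBr Lm /L scaler_suml -sumrB ip_sumr mulr_sumr.
  by apply: eq_bigr => p' _; rewrite -scalerBr ipZr mulrA.
have S2 : S + S = \sum_(p <- s) \sum_(p' <- s)
    l p * l p' * ip (p.2 - p'.2) (p.1 - p'.1).
  rewrite {2}/S exchange_big /= -big_split; apply: eq_bigr => p _ /=.
  rewrite -big_split; apply: eq_bigr => p' _ /=.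
  by rewrite ipBl !ipBr; ring.
have : 0 <= S + S.
  rewrite S2 big_seq sumr_ge0 // => p ps; rewrite big_seq sumr_ge0 // => p' ps'.
  by rewrite !mulr_ge0 ?smon ?l_ge0.
lra.
Qed.

(** The two sides differ by [t * (1 - t) * ip (P (x' - x)) (x' - x)]. *)
Lemma concave_along (P : 'End(H)) (v y x x' : H) (t : R) :
    (forall z, 0 <= ip (P z) z) -> 0 <= t -> t <= 1 ->
  (1 - t) * ip (v + P x) (y - x) + t * ip (v + P x') (y - x') <=
  ip (v + P (x + t *: (x' - x))) (y - (x + t *: (x' - x))).
Proof.
move=> Ppos t0 t1.
have := mulr_ge0 (mulr_ge0 t0 (_ : 0 <= 1 - t)) (Ppos (x' - x)).
rewrite subr_ge0 => /(_ t1).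
rewrite !(linearD P, linearN P, linearZ_LR P) /= !ip_linE.
lra.
Qed.

(** * Coordinates, continuity and compact boxes *)

Let n : nat := \dim {:H}.
Let b := vbasis {:H}.
Let toH (u : 'rV[R]_n) : H := \sum_(i < n) u 0 i *: b`_i.
Let toV (x : H) : 'rV[R]_n := \row_i coord b i x.

Lemma toVK : cancel toV toH.
Proof.
by move=> x; rewrite [RHS]vbasis_sum; apply: eq_bigr => i _; rewrite mxE.
Qed.

Lemma toHD (u v : 'rV[R]_n) (t : R) : toH (u + t *: v) = toH u + t *: toH v.
Proof.
rewrite /toH scaler_sumr -big_split; apply: eq_bigr => i _ /=.
by rewrite !mxE scalerDl scalerA.
Qed.

Lemma continuous_bigsum (T : topologicalType) (I : Type) (r : seq I)
    (f : I -> T -> R) :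
  (forall i, continuous (f i)) -> continuous (fun x => \sum_(i <- r) f i x).
Proof.
move=> cf; elim: r => [|i r IH] x.
  by under eq_fun do rewrite big_nil; exact: cvg_cst.
under eq_fun do rewrite big_cons.
by apply: cvgD; [exact: cf | exact: IH].
Qed.

Lemma continuous_neg_part_sqr (T : topologicalType) (f : T -> R) :
  continuous f -> continuous (fun x => Num.max 0 (- f x) ^+ 2).
Proof.
move=> cf x.
have cm : {for x, continuous (fun x => Num.max 0 (- f x))}.
  apply: (@continuous_max _ _ (fun=> 0) (fun x => - f x)).
    exact: cst_continuous.
  by apply: continuousN; exact: cf.
exact: (@continuousM R T _ _ x cm cm).
Qed.

Lemma continuous_ip_toH (c : H) : continuous (fun u => ip c (toH u)).
Proof.
under eq_fun do rewrite ip_sumr.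
apply: continuous_bigsum => i u; under eq_fun do rewrite ipZr.
apply: (@continuousM R 'rV[R]_n (fun u => u 0 i) (fun=> ip c b`_i)).
  exact: coord_continuous.
exact: cst_continuous.
Qed.

Lemma continuous_gap (P : 'End(H)) (v y : H) :
  continuous (fun u => ip (v + P (toH u)) (y - toH u)).
Proof.
have -> : (fun u => ip (v + P (toH u)) (y - toH u)) =
    (fun u => \sum_(i < n) u 0 i * (ip (P b`_i) y - ip (P b`_i) (toH u))
              + (ip v y - ip v (toH u))).
  apply/funext => u; rewrite ipDl ipBr [in RHS]addrC; congr (_ + _).
  rewrite {1}/toH linear_sum ip_suml; apply: eq_bigr => i _.
  by rewrite linearZ ipZl ipBr.
have cip c : continuous (fun u => ip c y - ip c (toH u)).
  move=> u; apply: (@continuousB R R 'rV[R]_n (fun=> ip c y)).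
    exact: cst_continuous.
  exact: continuous_ip_toH.
move=> u; apply: (@continuousD R R 'rV[R]_n); last exact: cip.
apply: continuous_bigsum => i {}u.
apply: (@continuousM R 'rV[R]_n (fun u => u 0 i)); last exact: cip.
exact: coord_continuous.
Qed.

Let box (M : R) : set 'rV[R]_n :=
  [set u | forall i, `[- M, M]%classic (u ord0 i)].

Lemma boxP M u : box M u <-> forall i, `|u 0 i| <= M.
Proof.
by split=> uM i; have := uM i; rewrite /= in_itv /= ler_norml.
Qed.

Lemma compact_box M : compact (box M).
Proof.
apply: (@rV_compact _ n (fun=> `[- M, M]%classic)) => i.
exact: segment_compact.
Qed.

(* Minimise the penalty [\sum_p max(0, - g_p)^2], where the gaps [g_p] are the
   concave functions below. At a minimiser [a] with positive penalty, moving
   towards the centroid of the points [p.1] weighted by [max(0, - g_p a)] would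
   decrease the penalty to first order. *)
Lemma finite_monotone_extension (P : 'End(H)) (s : seq (H * H)) (w : H) :
    (forall z, 0 <= ip (P z) z) ->
    (forall p p', p \in s -> p' \in s -> 0 <= ip (p.2 - p'.2) (p.1 - p'.1)) ->
  exists a, forall p, p \in s -> 0 <= ip (p.2 - w + P a) (p.1 - a).
Proof.
move=> Ppos smon.
pose g (p : H * H) (a : H) := ip (p.2 - w + P a) (p.1 - a).
pose pen (x : R) : R := Num.max 0 (- x).
pose f (u : 'rV[R]_n) : R := \sum_(p <- s) pen (g p (toH u)) ^+ 2.
(* A crude bound on all coordinates, so that the box contains every centroid of the points [p.1]. *)
pose M := \sum_(p <- s) \sum_(i < n) `|coord b i p.1|.
have coordM p i : p \in s -> `|coord b i p.1| <= M.
  move=> ps; rewrite /M (big_rem p ps) /= (bigD1 i) //= -addrA lerDl.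
  by rewrite addr_ge0 ?sumr_ge0 // => j _; rewrite sumr_ge0.
have M_ge0 : 0 <= M by rewrite sumr_ge0 // => p _; rewrite sumr_ge0.
have fc : continuous f.
  apply: continuous_bigsum => p.
  by apply: continuous_neg_part_sqr; exact: continuous_gap.
have [||u uM umin] := @compact_EVT_min _ _ f (box M) _ (@compact_box M).
- by exists 0; apply/boxP => i; rewrite mxE normr0.
- exact: continuous_subspaceT.
move: uM; rewrite inE => /boxP uM.
pose a := toH u; pose l p := pen (g p a).
have l_ge0 p : 0 <= l p by rewrite le_max lexx.
exists a => p ps; suff : l p <= 0 by rewrite ge_max oppr_le0 => /andP[].
rewrite leNgt; apply/negP => lp_gt0.
have f_gt0 : 0 < \sum_(p <- s) l p ^+ 2.
  rewrite (big_rem p ps) /= ltr_pwDl ?exprn_gt0 //.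
  by rewrite sumr_ge0 // => *; rewrite sqr_ge0.
have L_gt0 : 0 < \sum_(p <- s) l p.
  by rewrite (big_rem p ps) /= ltr_pwDl // sumr_ge0.
pose L := \sum_(p <- s) l p.
pose m := L^-1 *: \sum_(p <- s) l p *: p.1.
have Lm : L *: m = \sum_(p <- s) l p *: p.1.
  by rewrite scalerA mulfV ?scale1r // gt_eqF.
(* With the shift [P m - w] the terms become the gaps at [m] itself. *)
have := weighted_centroid_ge0 (P m - w) smon (fun p _ => l_ge0 p) L_gt0 Lm.
have -> : \sum_(p <- s) l p * ip (p.2 + (P m - w)) (p.1 - m) =
    \sum_(p <- s) l p * g p m.
  by apply: eq_bigr => p' _; rewrite /g addrA addrAC.
move=> gm_ge0.
have mM i : `|coord b i m| <= M.
  rewrite linearZ linear_sum /= normrM ger0_norm ?invr_ge0 ?(ltW L_gt0) //.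
  rewrite mulrC ler_pdivrMr // mulr_sumr (le_trans (ler_norm_sum _ _ _)) //.
  rewrite big_seq [leRHS]big_seq; apply: ler_sum => p' ps'.
  by rewrite linearZ normrM ger0_norm // mulrC ler_wpM2r // coordM.
(* By concavity, at parameter [t] on the segment from [a] to [m] each penalty root is at most the
   absolute value of [l p + t * (- g p m - l p)]. Summing squares bounds the penalty by
   [f u + 2 * t * S1 + t ^+ 2 * S2]. *)
pose S1 := \sum_(p <- s) l p * (- g p m - l p).
pose S2 := \sum_(p <- s) (- g p m - l p) ^+ 2.
have S1_lt0 : S1 < 0.
  suff -> : S1 = - (\sum_(p <- s) l p * g p m + \sum_(p <- s) l p ^+ 2) by lra.
  rewrite -big_split -sumrN; apply: eq_bigr => p' _ /=; ring.
have step t : 0 <= t -> t <= 1 -> 0 <= 2 * t * S1 + t ^+ 2 * S2.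
  move=> t0 t1; pose v := u + t *: (toV m - u).
  have vM : box M v.
    apply/boxP => i; rewrite !mxE.
    have -> : u 0 i + t * (coord b i m - u 0 i) =
      (1 - t) * u 0 i + t * coord b i m by ring.
    rewrite (le_trans (ler_normD _ _)) // !normrM (ger0_norm t0).
    rewrite (@ger0_norm _ (1 - t)) ?subr_ge0 //.
    have := ler_wpM2l t0 (mM i).
    have := @ler_wpM2l _ (1 - t) _ _ _ (uM i); rewrite subr_ge0 => /(_ t1).
    lra.
  have := umin v; rewrite inE => /(_ vM).
  suff : f v <= f u + (2 * t * S1 + t ^+ 2 * S2) by lra.
  rewrite /f /S1 /S2 !mulr_sumr -!big_split; apply: ler_sum => p' _ /=.
  have -> : toH v = a + t *: (m - a).
    rewrite toHD /a; congr (_ + _ *: _); rewrite -[toV m - u]addrC.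
    by rewrite -[- u]scaleN1r addrC toHD toVK scaleN1r.
  have := @concave_along P (p'.2 - w) p'.1 a m t Ppos t0 t1.
  rewrite /= -!/(g _ _) => gt.
  have gal : - g p' a <= l p' by rewrite le_max lexx orbT.
  have -> : pen (g p' (toH u)) = l p' by [].
  have -> : l p' ^+ 2 + (2 * t * (l p' * (- g p' m - l p')) +
    t ^+ 2 * (- g p' m - l p') ^+ 2) = (l p' + t * (- g p' m - l p')) ^+ 2.
    ring.
  rewrite /pen; case: (lerP 0 (- g p' (a + t *: (m - a)))) => [g0|_].
    have : - g p' (a + t *: (m - a)) <= l p' + t * (- g p' m - l p').
      have := @ler_wpM2l _ (1 - t) _ _ _ gal; rewrite subr_ge0 => /(_ t1).
      lra.
    by move=> gl; rewrite ler_pXn2r ?nnegrE // (le_trans g0).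
  by rewrite expr0n sqr_ge0.
have S2_ge0 : 0 <= S2 by rewrite sumr_ge0 // => *; rewrite sqr_ge0.
have D_gt0 : 0 < S2 - S1 by lra.
(* This [t] stays in []0, 1]] and gives [2 * S1 + t * S2 = (1 + t) * S1 < 0], contradicting
   minimality. *)
have t_gt0 : 0 < - S1 / (S2 - S1) by rewrite divr_gt0 // oppr_gt0.
have t_le1 : - S1 / (S2 - S1) <= 1 by rewrite ler_pdivrMr //; lra.
have tD : - S1 / (S2 - S1) * (S2 - S1) = - S1 by rewrite divfK // gt_eqF.
have := step _ (ltW t_gt0) t_le1.
move: (- S1 / (S2 - S1)) t_gt0 t_le1 tD => t t_gt0 t_le1 tD.
rewrite -mulrA mulrCA expr2 -mulrA -mulrDr pmulr_rge0 //.
have := mulr_gt0 t_gt0 (_ : 0 < - S1); rewrite oppr_gt0 => /(_ S1_lt0).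
lra.
Qed.
(** Finite intersection property: coercivity of [P] confines the solutions of one fixed constraint
    [p0] to a box, and finite subsystems are solvable. *)
Lemma monotone_extension (P : 'End(H)) (mu : R) (B : H -> set H) (w : H) :
    monotone ip B -> 0 < mu -> (forall z, mu * ip z z <= ip (P z) z) ->
  exists a, forall y v, B y v -> 0 <= ip (v - w + P a) (y - a).
Proof.
move=> Bmon mu_gt0 Pmu.
have Ppos z : 0 <= ip (P z) z.
  by rewrite (le_trans _ (Pmu z)) // mulr_ge0 ?ip_ge0 // ltW.
have [[p0 Bp0]|B0] := pselect (exists p : H * H, B p.1 p.2); last first.
  by exists 0 => y v Byv; case: B0; exists (y, v).
pose C p := [set u | 0 <= ip (p.2 - w + P (toH u)) (p.1 - toH u)].
have Cclosed p : closed (C p).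
  by apply: (closed_comp _ (@closed_ge _ 0)) => u _; exact: continuous_gap.
have [z zP] := coord_ip ip.
(* For [d = p0.1 - x], the constraint gives [mu * ip d d <= ip (P d) d <= ip (p0.2 - w + P p0.1) d];
   Cauchy-Schwarz then yields the radius. *)
pose r := hnorm ip (p0.2 - w + P p0.1) / mu.
pose M := \sum_(i < n) (`|coord b i p0.1| + r * hnorm ip (z i)).
have r_ge0 : 0 <= r by rewrite divr_ge0 ?hnorm_ge0 // ltW.
have C0box x : 0 <= ip (p0.2 - w + P x) (p0.1 - x) -> box M (toV x).
  move=> Cx; apply/boxP => i; rewrite mxE.
  have dr : hnorm ip (p0.1 - x) <= r.
    have [->//|d0] := eqVneq (hnorm ip (p0.1 - x)) 0.
    have d_gt0 : 0 < hnorm ip (p0.1 - x) by rewrite lt_def d0 hnorm_ge0.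
    rewrite ler_pdivlMr // mulrC -(ler_pM2r d_gt0) -mulrA -expr2 hnorm_sqr.
    apply: le_trans (ip_le _ _ _); apply: le_trans (Pmu _) _.
    by rewrite -subr_ge0 -ipBl (linearB P) opprB [P x - _]addrC addrA addrK.
  have xE : coord b i x = coord b i p0.1 - ip (p0.1 - x) (z i).
    by rewrite !zP ipBl opprB addrCA subrr addr0.
  rewrite xE /M (bigD1 i) //= (le_trans (ler_normB _ _)) // -addrA lerD2l.
  rewrite (le_trans (norm_ip_le _ _ _)) // ler_wpDr //.
    by rewrite sumr_ge0 // => j _; rewrite addr_ge0 // mulr_ge0 ?hnorm_ge0.
  by rewrite ler_wpM2r ?hnorm_ge0.
have := @compact_box M; rewrite compact_In0.
move=> /(_ _ [set p : H * H | B p.1 p.2] (fun p => box M `&` C p))[].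
- by exists C.
- move=> D DB.
  have [|a aP] :=
    (* Adding [p0] to the subsystem forces its solution into the box. *)
    @finite_monotone_extension P (p0 :: finmap.enum_fset D) w Ppos.
    have pB p : p \in p0 :: finmap.enum_fset D -> B p.1 p.2.
      by rewrite in_cons => /predU1P[->//|/DB/set_mem].
    by move=> p p' /pB Bp /pB Bp'; exact: Bmon.
  exists (toV a) => p pD; split; first by apply/C0box/aP; rewrite mem_head.
  by rewrite /C /= toVK aP // in_cons pD orbT.
by move=> u uP; exists (toH u) => y v Byv; have [_] := uP (y, v) Byv.
Qed.

(* Minty's theorem, with a linear map in place of the identity. *)
Lemma maximally_monotone_solvable (A : H -> set H) (mu : R) (Q : 'End(H))
    (w : H) :
    maximally_monotone ip A -> 0 < mu -> strongly_monotone ip mu A ->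
    possemidef ip Q ->
  exists a, A a (w - Q a).
Proof.
move=> [Amon Amax] mu_gt0 Astrong Qpos.
pose B : H -> set H := fun y => [set v | A y (v + mu *: y)].
pose P : 'End(H) := Q + mu *: \1%VF.
have PE x : P x = Q x + mu *: x by rewrite add_lfunE scale_lfunE id_lfunE.
have Bmon : monotone ip B.
  move=> y y' v v' /Astrong Av /Av; rewrite hnorm_sqr.
  by rewrite !ip_linE; lra.
have Pmu z : mu * ip z z <= ip (P z) z by rewrite PE ipDl ipZl lerDr Qpos.
have [a aP] := monotone_extension w Bmon mu_gt0 Pmu.
have {}aP y v : A y v -> 0 <= ip (v - (w - Q a)) (y - a).
  move=> Ayv; have := aP y (v - mu *: y); rewrite /B /= subrK => /(_ Ayv).
  have := mulr_ge0 (ltW mu_gt0) (ip_ge0 ip (y - a)).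
  by rewrite PE !ip_linE; lra.
(* Adjoining this one point keeps the graph monotone, so maximality puts it in [A]. *)
pose A' : H -> set H := fun y => A y `|` [set v | y = a /\ v = w - Q a].
exists a; apply: (Amax A') => [y y' v v'|y v|]; last by right.
- case=> [Av|[-> ->]]; case=> [Av'|[-> ->]].
  + exact: Amon.
  + exact: aP.
  + by have := aP _ _ Av'; rewrite !ip_linE; lra.
  + by rewrite !subrr ip0l.
- by left.
Qed.

End Minty.

(** * The resolvent and its cocoercivity *)

Section Resolvent.
Set Implicit Arguments.
Unset Strict Implicit.
Variables (R : realType) (H : vectType R) (ip : {dot H for idfun}).
Variables (A : H -> set H) (mu : R) (Q : 'End(H)).
Hypotheses (Amax : maximally_monotone ip A) (mu_gt0 : 0 < mu).
Hypotheses (Astrong : strongly_monotone ip mu A) (Qpos : posdef ip Q).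

Local Notation T := (resolvent A Q).
Local Notation q := (opnorm ip Q).

Lemma posdef_semidef : possemidef ip Q.
Proof.
by move=> x; have [->|/Qpos/ltW//] := eqVneq x 0; rewrite (linear0 Q) ip0l.
Qed.

(** Stated for the relation because it also gives the uniqueness that makes [T] well defined. *)
Lemma resolvent_rel_monotone a1 a2 b1 b2 :
    resolvent_rel A Q b1 a1 -> resolvent_rel A Q b2 a2 ->
  mu * ip (a1 - a2) (a1 - a2) + ip (Q (a1 - a2)) (a1 - a2) <=
  ip (Q (b1 - b2)) (a1 - a2).
Proof.
move=> [u1 Au1 E1] [u2 Au2 E2]; have := Astrong Au1 Au2.
rewrite hnorm_sqr (linearB Q b1) (linearB Q a1) /= -E1 -E2.
by rewrite !ip_linE; lra.
Qed.

(** Existence is Minty's theorem at [w = Q b]; uniqueness is the preceding estimate with equal base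
    points. *)
Lemma resolventP a b : a = T b <-> op_add A Q a (Q b).
Proof.
have Tb : resolvent_rel A Q b (T b).
  rewrite /resolvent; case: xgetP => [x _ //|none].
  have [x Ax] :=
    maximally_monotone_solvable (Q b) Amax mu_gt0 Astrong posdef_semidef.
  by case: (none x); exists (Q b - Q x) => //; rewrite subrK.
split=> [->//|ab]; apply/eqP; rewrite -subr_eq0; apply/eqP/(ip_eq0 (ip := ip)).
have := resolvent_rel_monotone ab Tb; rewrite subrr (linear0 Q) ip0l.
have := posdef_semidef (a - T b) => Qd le0.
by rewrite -(pmulr_rle0 _ mu_gt0); lra.
Qed.

Lemma resolvent_monotone b1 b2 (d := T b1 - T b2) :
  mu * ip d d + ip (Q d) d <= ip (Q (b1 - b2)) d.
Proof. by apply: resolvent_rel_monotone; exact/resolventP. Qed.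

(** Add [q] times the monotonicity estimate to [mu] times [ip (Q d) d <= q * ip d d]. This form
    avoids dividing by [q]. *)
Lemma resolvent_cocoercive_mul b1 b2 (d := T b1 - T b2) :
  (q + mu) * ip (Q d) d <= q * ip (Q (b1 - b2)) d.
Proof.
have := ler_wpM2l (opnorm_ge0 ip Q) (resolvent_monotone b1 b2).
have := ler_wpM2l (ltW mu_gt0) (sqnorm_le_opnorm ip Q d).
rewrite -/d; lra.
Qed.

Lemma resolvent_cocoercive : cocoercive ip Q (1 + mu / q) T.
Proof.
move=> b1 b2; rewrite /sqnorm_of /ip_of.
have := resolvent_monotone b1 b2; set d := T b1 - T b2 => le_d.
apply: le_trans le_d; rewrite mulrDl mul1r addrC lerD2r.
(* If [q = 0], then [H] is trivial and [mu / q] is [0] by convention. *)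
have [q0|q_neq0] := eqVneq q 0.
  by rewrite q0 invr0 mulr0 mul0r mulr_ge0 ?ip_ge0 // ltW.
rewrite -mulrA ler_pM2l // mulrC ler_pdivrMr.
  by rewrite mulrC sqnorm_le_opnorm.
by rewrite lt_def q_neq0 opnorm_ge0.
Qed.

(** Moving the adjoint across reduces the claim to [ip (Q d) d <= ip (Q b) d], the monotonicity
    estimate without its [mu] term. *)
Lemma residual_cocoercive : cocoercive ip (adjoint ip Q) 1 (fun b => b - T b).
Proof.
move=> b1 b2; rewrite /sqnorm_of /ip_of mul1r.
rewrite !(ipC ip (adjoint ip Q _)) -!adjointP.
rewrite subrACA.
have := resolvent_monotone b1 b2; set d := T b1 - T b2; set b := b1 - b2.
have := mulr_ge0 (ltW mu_gt0) (ip_ge0 ip d).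
rewrite (linearB Q b) /= !ip_linE; lra.
Qed.

Lemma opnorm_gt0 : (0 < \dim {:H})%N -> 0 < q.
Proof.
move=> dimH; rewrite lt_def opnorm_ge0 andbT; apply/eqP => q0.
have v0 : vpick {:H} != 0 by rewrite vpick0 -dimv_eq0 -lt0n.
have := sqnorm_le_opnorm ip Q (vpick {:H}).
by rewrite q0 mul0r leNgt Qpos.
Qed.

(** * Averagedness for symmetric [Q] *)

Hypothesis Qsym : selfadjoint ip Q.

Lemma ipQC x y : ip (Q x) y = ip (Q y) x.
Proof. by rewrite Qsym ipC. Qed.

(* The operator [K] in [F_(xi, alpha)] is forced to be
   [I + alpha^-1 (S - I)]. *)
Lemma Fclass_intro (xi al : R) (S : H -> H) :
    0 < xi -> 0 < al -> al < 1 ->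
    (forall b1 b2, sqnorm_of ip Q ((S b1 - S b2) - (1 - al) *: (b1 - b2)) <=
       (al * xi) ^+ 2 * sqnorm_of ip Q (b1 - b2)) ->
  Fclass ip Q xi al S.
Proof.
move=> xi0 al0 al1 SP; split => //.
exists (fun b => al^-1 *: (S b - (1 - al) *: b)); last first.
  by move=> b; rewrite scalerA mulfV ?gt_eqF // scale1r addrC subrK.
move=> b1 b2; have := SP b1 b2; rewrite /sqnorm_of.
have -> : al^-1 *: (S b1 - (1 - al) *: b1) - al^-1 *: (S b2 - (1 - al) *: b2) =
    al^-1 *: (S b1 - S b2 - (1 - al) *: (b1 - b2)).
  by rewrite -scalerBr subrACA -scalerBr.
set z := S b1 - _ - _.
rewrite (linearZ_LR Q) ipZl ipZr mulrA -expr2 exprMn -mulrA.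
by rewrite exprVn ler_pdivrMl ?exprn_gt0.
Qed.

(** Completing the square: symmetry merges the two cross terms into [2 * c * ip (Q b) d]. *)
Lemma sqnorm_shift_le (c : R) d b :
  ip (Q d) d <= 2 * c * ip (Q b) d ->
  ip (Q (d - c *: b)) (d - c *: b) <= c ^+ 2 * ip (Q b) b.
Proof. by rewrite (linearB Q) (linearZ_LR Q) /= !ip_linE (ipQC d b); lra. Qed.

(** One estimate on [d - c *: b] serves both maps, since the residual's difference [b - d] minus
    [(1 - c) *: b] is [- (d - c *: b)]. *)
Lemma resolvent_Fclass (c : R) : 0 < c -> c < 1 ->
    (forall b1 b2, ip (Q (T b1 - T b2)) (T b1 - T b2) <=
                   2 * c * ip (Q (b1 - b2)) (T b1 - T b2)) ->
  Fclass ip Q (c / (1 - c)) (1 - c) T /\ Fclass ip Q 1 c (fun b => b - T b).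
Proof.
move=> c0 c1 cP; have c1' : 0 < 1 - c by rewrite subr_gt0.
split; apply: Fclass_intro => //; rewrite ?divr_gt0 //; first lra.
  move=> b1 b2; rewrite [(1 - c) * _]mulrC divfK ?gt_eqF // subKr.
  exact: sqnorm_shift_le.
move=> b1 b2; rewrite mulr1 subrACA.
have := cP b1 b2; move: (T b1 - T b2) (b1 - b2) => d b db.
have -> : b - d - (1 - c) *: b = - (d - c *: b).
  by rewrite scalerBl scale1r subrACA subrr sub0r.
by rewrite /sqnorm_of (linearN Q) ipNl ipNr opprK; exact: sqnorm_shift_le.
Qed.

End Resolvent.

Theorem lemma2p3 (R : realType) (H : vectType R) (ip : {dot H for idfun})
    (A : H -> set H) (mu : R) (Q : 'End(H))
    (Amax : maximally_monotone ip A)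
    (mu_gt0 : 0 < mu) (Astrong : strongly_monotone ip mu A)
    (Qpos : posdef ip Q) :
  let T : H -> H := resolvent A Q in
  let Rop : H -> H := fun b => b - T b in
  let q : R := opnorm ip Q in
  (* T is well defined: single-valued, with full domain *)
  (forall a b, a = T b <-> op_add A Q a (Q b)) /\
  (* (i) *)
  (cocoercive ip Q (1 + mu / q) T /\ cocoercive ip (adjoint ip Q) 1 Rop) /\
  (* (ii); the parameters lie in the required ranges only if H is not {0} *)
  ((0 < \dim {:H})%N -> selfadjoint ip Q -> possemidef ip Q ->
    Fclass ip Q (q / (2 * mu + q)) ((2 * mu + q) / (2 * mu + 2 * q)) T /\
    Fclass ip Q 1 (q / (2 * (q + mu))) Rop) /\
  (* (iii) *)
  (selfadjoint ip Q -> possemidef ip Q ->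
    firmly_nonexpansive ip Q T /\ firmly_nonexpansive ip Q Rop) /\
  (* (iv) *)
  (selfadjoint ip Q -> posdef ip Q ->
    forall b1 b2,
      (q + mu) / (q + 2 * mu) * sqnorm_of ip Q (Rop b1 - Rop b2)
        + mu / (q + 2 * mu) * sqnorm_of ip Q (b1 - b2)
      <= ip_of ip Q (b1 - b2) (Rop b1 - Rop b2)).
Proof.
move=> T Rop q.
have q_ge0 : 0 <= q := opnorm_ge0 ip Q.
have key := resolvent_cocoercive_mul Amax mu_gt0 Astrong Qpos.
split; first exact: (resolventP Amax mu_gt0 Astrong Qpos).
split.
  split; first exact: (resolvent_cocoercive Amax mu_gt0 Astrong Qpos).
  exact: (residual_cocoercive Amax mu_gt0 Astrong Qpos).
split.
  move=> dimH Qsym _; have q_gt0 : 0 < q := opnorm_gt0 Qpos dimH.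
  (* Chosen so that [2 * c = q / (q + mu)], the constant in [key]. *)
  pose c := q / (2 * (q + mu)).
  have c0 : 0 < c by rewrite divr_gt0 //; lra.
  have c1 : c < 1 by rewrite ltr_pdivrMr; lra.
  have := resolvent_Fclass Qsym c0 c1.
  have -> : 1 - c = (2 * mu + q) / (2 * mu + 2 * q) by rewrite /c; field; lra.
  have -> : c / ((2 * mu + q) / (2 * mu + 2 * q)) = q / (2 * mu + q).
    by rewrite /c; field; lra.
  apply=> b1 b2; have := key b1 b2; rewrite /= -/T -/q.
  have -> : 2 * c = q / (q + mu) by rewrite /c; field; lra.
  by rewrite mulrAC ler_pdivlMr 1?mulrC //; lra.
split.
  (* Here [c = 1/2]: the estimate required is monotonicity with the [mu] term dropped, which also
     covers [H = {0}]. *)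
  move=> Qsym _; have h0 : 0 < 2^-1 :> R by lra.
  have h1 : 2^-1 < 1 :> R by lra.
  have := resolvent_Fclass Qsym h0 h1.
  have -> : 1 - 2^-1 = 2^-1 :> R by lra.
  rewrite !divff ?(gt_eqF h0) ?pnatr_eq0 // => F; apply: F => b1 b2.
  have := resolvent_monotone Amax mu_gt0 Astrong Qpos b1 b2.
  have := mulr_ge0 (ltW mu_gt0) (ip_ge0 ip (T b1 - T b2)).
  by rewrite /T; lra.
move=> Qsym _ b1 b2; rewrite /Rop /sqnorm_of /ip_of subrACA.
have := key b1 b2; rewrite /= -/T -/q.
move: (T b1 - T b2) (b1 - b2) => d b db.
have D_gt0 : 0 < q + 2 * mu by lra.
(* With denominators cleared and the forms expanded, the [ip (Q b) b] terms cancel and exactly [key]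
   remains. *)
rewrite -(ler_pM2r D_gt0).
rewrite (linearB Q) /= !ip_linE (ipQC Qsym d b).
have -> : forall x y : R, ((q + mu) / (q + 2 * mu) * x + mu / (q + 2 * mu) * y)
    * (q + 2 * mu) = (q + mu) * x + mu * y by move=> x y; field; lra.
lra.
Qed.
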